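(* Let $L$ and $n$ be positive integers. The map $\rho:B\mapsto(\rho_N(B),\rho_Q(B))$ is a bijection \[\rho:\ \mathcal M(L,n)\longrightarrow\bigcup_\mu\mathrm{MLQ}_0(\mu,n)\times\mathrm{SSYT}(\mu',L),\] where the union is over partitions $\mu$, and it satisfies $x^B=x^{\rho_N(B)}$ for all $B\in\mathcal M(L,n)$.
   Context: Partitions and tableaux. $\mu'$ is the conjugate of $\mu$, $\ell(\mu)$ its length. Diagrams are in French notation (row 1 at bottom). A semistandard Young tableau (SSYT) has entries weakly increasing left to right along rows and strictly increasing up columns; $\mathrm{SSYT}(\nu,L)$ is the set of SSYT of shape $\nu$ with entries in $[L]$. Binary matrices and multiline queues. $\mathcal M(L,n)$ is the set of tuples $B=(B_1,\dots,B_L)$ of subsets of $[n]$, drawn as a grid with rows $1..L$ bottom to top, columns $1..n$ left to right, ball in $(r,j)$ iff $j\in B_r$; weight $x^B=\prod_r\prod_{b\in B_r}x_b$. For a partition $\mu$ with $n\ge\ell(\mu)$, $\mathrm{MLQ}(\mu,n)$ is the set of tuples $(B_1,\dots,B_{\mu_1})$ of subsets of $[n]$ with $|B_j|=\mu'_j$; tuples with empty top rows are identified with the tuple obtained by deleting those rows. $\mathrm{cw}(B)$ scans columns left to right, each column top to bottom, recording row numbers of balls. Major index. For $M\in\mathrm{MLQ}(\mu,n)$, $L'=\mu_1$: for $r=L',\dots,2$, unlabelled balls of row $r$ get label $r$; then the balls of row $r$ in decreasing label order (left to right among ties) are each paired with the first unlabelled ball of row $r-1$ weakly to the right, cyclically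 modulo $n$, which receives the same label; the pairing wraps if the lower ball lies strictly left of the upper ball. $\operatorname{maj}(M)=\sum(\ell(p)-r(p)+1)$ over wrapping pairings, $r(p)$ the upper row, $\ell(p)$ the label. $\mathrm{MLQ}_0(\mu,n)=\{M\in\mathrm{MLQ}(\mu,n):\operatorname{maj}(M)=0\}$. Collapsing. For a word $w$ and $i\ge1$, $\mathrm{Par}_i(w)$ writes ''('' for each $i+1$ and '')'' for each $i$ (left to right) and iteratively matches a ''('' with a '')'' to its right when adjacent or separated only by matched parentheses. $e_i^\star(B)$ moves every ball of row $i+1$ whose letter in $\mathrm{cw}(B)$ is unmatched in $\mathrm{Par}_i(\mathrm{cw}(B))$ down to row $i$ in the same column. Products act right to left; $e^\star_{[a,b]}=e^\star_ae^\star_{a+1}\cdots e^\star_b$; $\rho_N(B)=e^\star_{[1,L-1]}\cdots e^\star_{[1,2]}e^\star_{[1,1]}(B)$. With $N^{(k)}$ the bottom $k$ rows of $e^\star_{[1,k-1]}\cdots e^\star_{[1,1]}(B)$ ($1\le k\le L$) and $N^{(0)}$ empty, $\rho_Q(B)$ is the filling whose row $r$ contains $|N^{(i)}_r|-|N^{(i-1)}_r|$ entries $i$ for $i=1,\dots,L$ (with $|N^{(i-1)}_i|=0$), in weakly increasing order. *)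

(* Defs.v *)
From HB Require Import structures.
From mathcomp Require Import all_boot all_order all_algebra.
From mathcomp Require Import mpoly.
Set Implicit Arguments.
Unset Strict Implicit.
Unset Printing Implicit Defensive.
Import GRing.Theory.

(* Conventions.  A binary matrix / multiline queue with columns [1..n] is a
   [seq {set 'I_n}]; the k-th element (index k-1) is row k (rows bottom to
   top); column j of the paper is the ordinal j-1.  Row numbers are 1-based. *)

Section Defs.
Variable n : nat.
Implicit Types (B M : seq {set 'I_n}).

Definition row B (r : nat) : {set 'I_n} := nth set0 B r.-1.

Fixpoint drop_pref {T : Type} (p : pred T) (s : seq T) : seq T :=
  if s is x :: s' then (if p x then drop_pref p s' else s) else [::].
Definition trim_top {T : Type} (p : pred T) (s : seq T) : seq T :=
  rev (drop_pref p (rev s)).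

Definition is_partition (mu : seq nat) : bool :=
  sorted geq mu && all (fun m => 0 < m) mu.
Definition conj_part (mu : seq nat) : seq nat :=
  [seq count (fun m => j <= m) mu | j <- iota 1 (head 0 mu)].

(* ---------- column word: letters are (row number, column) of the balls,
   columns left to right, each column top to bottom *)
Definition cwp B : seq (nat * 'I_n) :=
  flatten [seq [seq (r, j) | r <- rev (iota 1 (size B)) & j \in row B r]
          | j <- enum 'I_n].
Definition cw B : seq nat := map fst (cwp B).

(* ---------- Par_i : bracket matching.  Letters i+1 are "(", letters i are
   ")", other letters are ignored.  The iterative matching of the paper is
   computed by the usual stack scan: a ")" matches the most recent still
   unmatched "(".  The result lists the columns of the balls of row i+1
   whose letter is unmatched. *)
Definition par_step (i : nat) (st : seq 'I_n) (p : nat * 'I_n) : seq 'I_n :=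
  if p.1 == i.+1 then p.2 :: st
  else if p.1 == i then behead st else st.
Definition unmatched_cols (i : nat) B : seq 'I_n := foldl (par_step i) [::] (cwp B).

Definition estar (i : nat) B : seq {set 'I_n} :=
  let U := [set j | j \in unmatched_cols i B] in
  mkseq (fun k => let r := k.+1 in
                  if r == i then row B r :|: U
                  else if r == i.+1 then row B r :\: U
                  else row B r) (size B).

Definition estar_int (k : nat) B : seq {set 'I_n} := foldr estar B (iota 1 k).

Definition stage (k : nat) B : seq {set 'I_n} :=
  foldl (fun C k' => estar_int k' C) B (iota 1 k.-1).

Definition rhoN B : seq {set 'I_n} := stage (size B) B.

(* |N^(i)_r| with |N^(i)_r| = 0 when r > i (and N^(0) empty) *)
Definition cntN B (i r : nat) : nat :=
  if (1 <= i) && (r <= i) then #|row (stage i B) r| else 0.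

Definition rhoQ_row B (r : nat) : seq nat :=
  flatten [seq nseq (cntN B i r - cntN B i.-1 r) i | i <- iota 1 (size B)].

Definition rhoQ B : seq (seq nat) :=
  trim_top (@nilp nat) (mkseq (fun k => rhoQ_row B k.+1) (size B)).

(* rho(B) : the multiline queue rho_N(B) (with empty top rows removed,
   as in the identification of the paper) together with rho_Q(B) *)
Definition rho B : seq {set 'I_n} * seq (seq nat) :=
  (trim_top (fun Z : {set 'I_n} => Z == set0) (rhoN B), rhoQ B).

Definition weight B : {mpoly int[n]} := \prod_(Z <- B) \prod_(b in Z) 'X_b.

Definition rowN B (r : nat) : seq nat := [seq val d | d <- enum (row B r)].

(* label of the ball in column c of the current row: the one it received
   from the pairing with the row above, or r if it is unlabelled *)
Definition full_labels (upper : seq nat) (lab : seq (nat * nat)) (r : nat)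
  : seq (nat * nat) :=
  [seq (c, head r [seq q.2 | q <- lab & q.1 == c]) | c <- upper].

Definition pairing_order (fl : seq (nat * nat)) (Lmax : nat) : seq (nat * nat) :=
  flatten [seq [seq q <- fl | q.2 == l] | l <- rev (iota 0 Lmax.+1)].

(* pair the upper ball p = (column, label) of row r with the first unlabelled
   ball of row r-1 weakly to its right, cyclically mod n; accumulate
   label - r + 1 if the pairing wraps *)
Definition pair_step (lower : seq nat) (r : nat)
    (st : seq (nat * nat) * nat) (p : nat * nat) : seq (nat * nat) * nat :=
  let: (lab, acc) := st in
  let c := p.1 in let l := p.2 in
  let cands := [seq d <- [seq (c + k) %% n | k <- iota 0 n]
               | (d \in lower) && (d \notin map fst lab)] in
  if cands is d :: _ then ((d, l) :: lab, acc + (if d < c then l - r + 1 else 0))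
  else (lab, acc).

Definition maj_step M (st : seq (nat * nat) * nat) (r : nat) : seq (nat * nat) * nat :=
  let: (lab, acc) := st in
  let fl := full_labels (rowN M r) lab r in
  foldl (pair_step (rowN M r.-1) r) ([::], acc) (pairing_order fl (size M)).

Definition maj M : nat :=
  (foldl (maj_step M) ([::], 0) (rev (iota 2 (size M).-1))).2.

Definition in_MLQ (mu : seq nat) M : bool :=
  [&& is_partition mu, size mu <= n & map (fun Z : {set 'I_n} => #|Z|) M == conj_part mu].
Definition in_MLQ0 (mu : seq nat) M : bool := in_MLQ mu M && (maj M == 0).

End Defs.

(* ---------- SSYT(nu, L), French notation, rows listed bottom to top *)
Definition is_SSYT (nu : seq nat) (L : nat) (T : seq (seq nat)) : Prop :=
  [/\ [seq size t | t <- T] = nu,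
      forall r, sorted leq (nth [::] T r),
      forall r x, x \in nth [::] T r -> 1 <= x <= L &
      forall r c, c < size (nth [::] T r.+1) ->
                  nth 0 (nth [::] T r) c < nth 0 (nth [::] T r.+1) c].

Definition in_target (n L : nat) (p : seq {set 'I_n} * seq (seq nat)) : Prop :=
  exists mu : seq nat, in_MLQ0 mu p.1 /\ is_SSYT (conj_part mu) L p.2.

(* Main.v *)
Require Import Defs.
From HB Require Import structures.
From mathcomp Require Import all_boot all_order all_algebra.
From mathcomp Require Import mpoly.
From mathcomp Require Import zify.
Set Implicit Arguments.
Unset Strict Implicit.
Unset Printing Implicit Defensive.

(**
  Everything is read off the suffix counts [balls_from A k], the number of
  balls of the row A in the columns >= k.  The set U of unmatched balls of an
  upper row A over a lower row C is characterised by: U is contained in A and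
  disjoint from C, and the counts of A are at most those of C plus those of U,
  with equality at every column of U.

  Applying e*_k, ..., e*_1 to k rows, each of which dominates the next one up
  in all suffix counts, topped by an arbitrary row, yields k+1 rows with the
  same property, and the two lists of row sizes interlace.  This step is
  inverted from the bottom row up: if P is A without U, X is the union of C and
  U, and u = #|U|, then the count of U at k is the minimum of u and of the
  differences between the counts of X and of P at the columns <= k, so that U,
  hence A and C, are recovered from P, X and u.  Thus B corresponds to a
  dominating list of rows together with an interlacing chain of size lists,
  that is, with a semistandard tableau.  Finally, maj vanishes exactly on
  the dominating lists: a greedy pairing, in whatever order, never wraps under
  domination, and a pairing without wrapping is an injection moving weakly to
  the right.
*)

Local Notation row := Defs.row.

(** * Sets, sequences and partitions *)

Lemma setUDK (T : finType) (A U : {set T}) :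
  [disjoint A & U] -> (A :|: U) :\: U = A.
Proof. by move=> AU; rewrite setDUl setDv setU0; apply/setDidPl. Qed.

Lemma setDUK (T : finType) (A U : {set T}) : U \subset A -> (A :\: U) :|: U = A.
Proof. by move=> UA; rewrite setUC -{1}(setIidPr UA) setID. Qed.

Lemma big_setU_disjoint (R : Type) (idx : R) (op : Monoid.com_law idx)
    (I : finType) (A B : {set I}) (F : I -> R) : [disjoint A & B] ->
  \big[op/idx]_(i in A :|: B) F i =
    op (\big[op/idx]_(i in A) F i) (\big[op/idx]_(i in B) F i).
Proof. by move=> AB; rewrite -bigU //; apply: eq_bigl => i; rewrite !inE. Qed.

Lemma foldl_flatten_map (R I J : Type) (f : R -> J -> R) (g : I -> seq J)
    (h : R -> I -> R) z s : (forall y i, foldl f y (g i) = h y i) ->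
  foldl f z (flatten (map g s)) = foldl h z s.
Proof. by move=> fgh; elim: s z => //= i s IHs z; rewrite foldl_cat fgh. Qed.

Lemma foldl_enum_ord_ind n (R : Type) (P : nat -> R -> Prop)
    (f : R -> 'I_n -> R) z :
  P 0 z -> (forall (j : 'I_n) y, P j y -> P j.+1 (f y j)) ->
  P n (foldl f z (enum 'I_n)).
Proof.
move=> P0 PS.
suff: forall m, m <= n -> P m (foldl f z (take m (enum 'I_n))).
  by move/(_ n (leqnn n)); rewrite take_oversize // size_enum_ord.
elim=> [_|m IHm mn]; first by rewrite take0.
rewrite (take_nth (Ordinal mn)) ?size_enum_ord // foldl_rcons.
by rewrite -[m]/(val (Ordinal mn)) nth_ord_enum; apply/PS/IHm/ltnW.
Qed.

Lemma perm_flatten_fibers (T S : eqType) (key : T -> S) ks (s : seq T) :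
  uniq ks -> all (fun x => key x \in ks) s ->
  perm_eq (flatten [seq [seq x <- s | key x == k] | k <- ks]) s.
Proof.
elim: ks s => [|k ks IHks] s /=; first by case: s.
case/andP=> k_ks uniq_ks all_s.
rewrite perm_sym -(perm_filterC (fun x => key x == k)) perm_cat2l perm_sym.
set s' := filter (predC _) s.
have -> : [seq [seq x <- s | key x == l] | l <- ks] =
          [seq [seq x <- s' | key x == l] | l <- ks].
  apply/eq_in_map => l l_ks; rewrite -filter_predI; apply: eq_filter => x /=.
  by case: eqP => //= ->; rewrite (memPn k_ks).
apply: IHks => //; apply/allP => x; rewrite mem_filter => /andP[/= x_k].
by move/(allP all_s); rewrite inE (negbTE x_k).
Qed.

Section SortedFilter.
Variables (T : Type) (r : rel T) (a : pred T).
Hypotheses (r_trans : transitive r) (a_down : forall x y, r x y -> a y -> a x).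
Implicit Type s : seq T.

Lemma cat_filter_sorted s :
  sorted r s -> filter a s ++ filter (predC a) s = s.
Proof.
elim: s => //= x s IHs sorted_xs.
have {}IHs := IHs (path_sorted sorted_xs).
case: (boolP (a x)) => [ax|nax] /=; first by rewrite IHs.
have all_Na : all (predC a) s.
  apply: sub_all (order_path_min r_trans sorted_xs) => y rxy /=.
  by apply: contra nax; apply: a_down.
suff -> : filter a s = [::] by rewrite /= (all_filterP all_Na).
by apply/nilP; rewrite /nilp size_filter eqn0Ngt -has_count -all_predC.
Qed.

Lemma ltn_count_sorted x0 s i :
  sorted r s -> i < size s -> (i < count a s) = a (nth x0 s i).
Proof.
move=> sorted_s; rewrite -{1 3}(cat_filter_sorted sorted_s).
rewrite nth_cat size_cat !size_filter => i_s.
have [i_a|a_i] := ltnP.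
  by apply/esym/(all_nthP x0 (filter_all a s)); rewrite size_filter.
apply/esym/negbTE/(all_nthP x0 (filter_all (predC a) s)).
by rewrite size_filter; lia.
Qed.

End SortedFilter.

Section NatSequences.
Implicit Types s t : seq nat.

Lemma sorted_geq_nth s i j :
  sorted geq s -> i <= j -> nth 0 s j <= nth 0 s i.
Proof.
move=> sorted_s ij; have [js|sj] := ltnP j (size s); last first.
  by rewrite nth_default.
apply: (sorted_leq_nth (rev_trans leq_trans) leqnn) => //; rewrite ?inE //.
exact: leq_ltn_trans js.
Qed.

Lemma ltn_count_geq s i k : sorted geq s ->
  (i < count (leq k.+1) s) = (k < nth 0 s i).
Proof.
move=> sorted_s; have [i_s|s_i] := ltnP i (size s).
  apply: (ltn_count_sorted (r := geq)) => //; first exact: rev_trans leq_trans.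
  by move=> x y /= yx ky; apply: leq_trans yx.
rewrite nth_default // ltn0.
by apply/negbTE; rewrite -leqNgt (leq_trans (count_size _ _)).
Qed.

Lemma nth_leq_count s c y : sorted leq s -> c < size s ->
  (nth 0 s c <= y) = (c < count (leq^~ y) s).
Proof.
move=> sorted_s c_s; apply/esym; apply: (ltn_count_sorted (r := leq)) => //.
  exact: leq_trans.
by move=> u v /=; apply: leq_trans.
Qed.

Lemma eq_sorted_count_leq L s t :
  sorted leq s -> sorted leq t -> all (geq L) s -> all (geq L) t ->
  (forall k, k <= L -> count (leq^~ k) s = count (leq^~ k) t) -> s = t.
Proof.
move=> sorted_s sorted_t s_L t_L eq_st.
have size_st : size s = size t.
  have := eq_st L (leqnn L).
  by move: s_L t_L; rewrite !all_count => /eqP-> /eqP->.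
apply: (@eq_from_nth _ 0) => // c c_s.
have c_t : c < size t by rewrite -size_st.
have s_c : nth 0 s c <= L := all_nthP 0 s_L c c_s.
have t_c : nth 0 t c <= L := all_nthP 0 t_L c c_t.
apply/anti_leq/andP; split; rewrite nth_leq_count //.
  by rewrite eq_st // -nth_leq_count.
by rewrite -eq_st // -nth_leq_count.
Qed.

End NatSequences.

Section Trim.
Variables (T : Type) (p : pred T).
Implicit Types s t : seq T.

Lemma drop_pref_cat s t : all p s -> drop_pref p (s ++ t) = drop_pref p t.
Proof. by elim: s => //= x s IHs /andP[-> /IHs]. Qed.

Lemma trim_top_cat s t :
  all (predC p) s -> all p t -> trim_top p (s ++ t) = s.
Proof.
move=> all_s all_t; rewrite /trim_top rev_cat drop_pref_cat ?all_rev //.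
case/lastP: s all_s => [|s x] //; rewrite all_rcons => /andP[/= /negbTE px _].
by rewrite rev_rcons /= px rev_cons revK.
Qed.

Lemma trim_top_sorted (r : rel T) s :
  transitive r -> (forall x y, r x y -> p x -> p y) -> sorted r s ->
  trim_top p s = filter (predC p) s.
Proof.
move=> r_trans p_up sorted_s; have p_down x y : r x y -> predC p y -> predC p x.
  by move/p_up=> pxy; apply: contra.
rewrite -[in LHS](cat_filter_sorted r_trans p_down sorted_s) trim_top_cat //.
  exact: filter_all.
by apply: sub_all (filter_all _ _) => x; rewrite /= negbK.
Qed.

Variable x0 : T.

Lemma trim_top_eq s t : p x0 -> all (predC p) t -> nth x0 s =1 nth x0 t ->
  trim_top p s = t.
Proof.
move=> p_x0 all_t eq_nth; have size_le : size t <= size s.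
  rewrite leqNgt; apply/negP => st.
  have /(_ (size s) st) := all_nthP x0 all_t.
  by rewrite -eq_nth nth_default //= p_x0.
suff -> : s = t ++ drop (size t) s.
  rewrite trim_top_cat //; apply/(all_nthP x0) => i _.
  by rewrite nth_drop eq_nth nth_default // leq_addr.
rewrite -{1}(cat_take_drop (size t) s); congr (_ ++ _).
apply: (@eq_from_nth _ x0) => [|i]; rewrite size_takel // => it.
by rewrite nth_take.
Qed.

Hypothesis p_eq_x0 : forall x, p x -> x = x0.

Lemma nth_trim_top s : nth x0 (trim_top p s) =1 nth x0 s.
Proof.
move=> i; rewrite /trim_top; elim/last_ind: s => [|s x IHs] //.
rewrite rev_rcons /=.
case: ifP => [/p_eq_x0 ->|_]; last by rewrite rev_cons revK.
rewrite IHs nth_rcons; case: ltngtP => // [?|->]; last by rewrite nth_default.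
by rewrite nth_default // ltnW.
Qed.

Lemma trim_top_inj s t :
  size s = size t -> trim_top p s = trim_top p t -> s = t.
Proof.
move=> size_st eq_trim; apply: (@eq_from_nth _ x0) => // i _.
by rewrite -(nth_trim_top s i) eq_trim nth_trim_top.
Qed.

End Trim.

Lemma map_trim_top (T S : Type) (p : pred T) (q : pred S) (f : T -> S) s :
  (forall x, q (f x) = p x) -> map f (trim_top p s) = trim_top q (map f s).
Proof.
move=> qf; rewrite /trim_top -[rev (map f s)]map_rev map_rev; congr (rev _).
by elim: (rev s) => //= x s' IHs; rewrite qf; case: (p x).
Qed.

Section ConjugatePartition.
Implicit Types mu nu : seq nat.

Lemma size_conj_part mu : size (conj_part mu) = head 0 mu.
Proof. by rewrite size_map size_iota. Qed.

Lemma nth_conj_part mu i :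
  i < head 0 mu -> nth 0 (conj_part mu) i = count (leq i.+1) mu.
Proof. by move=> i_mu; rewrite (nth_map 0) ?size_iota // nth_iota. Qed.

Lemma conj_part_partition mu : is_partition (conj_part mu).
Proof.
apply/andP; split.
  apply/(sortedP 0) => i; rewrite size_conj_part => i_mu.
  rewrite !nth_conj_part // ?(ltnW i_mu) //.
  by apply: sub_count => m; apply: ltnW.
apply/allP => _ /(nthP 0)[i + <-]; rewrite size_conj_part => i_mu.
by rewrite nth_conj_part // -has_count; case: mu i_mu => //= m mu ->.
Qed.

Lemma conj_partK nu : is_partition nu -> conj_part (conj_part nu) = nu.
Proof.
case/andP=> sorted_nu pos_nu; have head_conj : head 0 (conj_part nu) = size nu.
  case: nu pos_nu {sorted_nu} => [|[|m] nu] //= pos_nu.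
  by congr _.+1; apply/eqP; rewrite -all_count.
apply: (@eq_from_nth _ 0); rewrite size_conj_part head_conj // => i i_nu.
rewrite nth_conj_part ?head_conj // count_map.
have nu_i : nth 0 nu i <= head 0 nu by rewrite -nth0 sorted_geq_nth.
rewrite -[RHS](size_iota 1) -(filter_iota_ltn 1 nu_i) size_filter.
apply: eq_in_count => -[|j]; rewrite mem_iota // => _ /=.
by rewrite ltn_count_geq // add1n ltnS.
Qed.

End ConjugatePartition.

(** * Suffix counts and domination *)

Section SuffixCounts.
Variable n : nat.
Implicit Types (A C U : {set 'I_n}) (k m : nat) (j : 'I_n).

Definition balls_in A k m := #|[set i in A | k <= i < m]|.
Definition balls_from A k := balls_in A k n.

Lemma balls_inS A k j :
  balls_in A k j.+1 = ((j \in A) && (k <= j)) + balls_in A k j.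
Proof.
rewrite /balls_in (cardsD1 j) !inE ltnSn andbT; congr (_ + #|pred_of_set _|).
apply/setP => i; rewrite !inE andbCA -val_eqE /=; congr (_ && _).
by rewrite ltnS [in RHS]ltn_neqAle andbCA.
Qed.

Lemma balls_in_empty A k m : m <= k -> balls_in A k m = 0.
Proof. by move=> mk; apply: eq_card0 => i; rewrite !inE; lia. Qed.

Lemma balls_from_oversize A k : n <= k -> balls_from A k = 0.
Proof.
by move=> nk; apply: eq_card0 => i; rewrite !inE; have := ltn_ord i; lia.
Qed.

Lemma balls_fromS A j : balls_from A j = (j \in A) + balls_from A j.+1.
Proof.
rewrite /balls_from /balls_in (cardsD1 j) !inE leqnn ltn_ord !andbT.
congr (_ + #|pred_of_set _|).
apply/setP => i; rewrite !inE andbCA -val_eqE /=; congr (_ && _).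
by rewrite [in RHS]ltn_neqAle [j == i :> nat]eq_sym andbA.
Qed.

Lemma balls_from0 A : balls_from A 0 = #|A|.
Proof. by apply: eq_card => i; rewrite !inE ltn_ord !andbT. Qed.

Lemma balls_from_set0 k : balls_from set0 k = 0.
Proof. by apply: eq_card0 => i; rewrite !inE. Qed.

Lemma balls_from_setU A U k : [disjoint A & U] ->
  balls_from (A :|: U) k = balls_from A k + balls_from U k.
Proof.
rewrite -setI_eq0 => /eqP AU0; rewrite /balls_from /balls_in.
rewrite -cardsUI [X in _ = _ + #|pred_of_set X|](_ : _ = set0) ?cards0 ?addn0.
  by apply: eq_card => i; rewrite !inE andb_orl.
by rewrite !setIdE setIACA AU0 set0I.
Qed.

Lemma balls_from_setD A U k : U \subset A ->
  balls_from (A :\: U) k + balls_from U k = balls_from A k.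
Proof.
move=> UA; rewrite -balls_from_setU ?disjoints_subset ?subsetDr //.
by rewrite setDUK.
Qed.

Lemma leq_balls_from A k m : k <= m -> balls_from A m <= balls_from A k.
Proof.
move=> km; apply: subset_leq_card; apply/subsetP => i; rewrite !inE.
by case/andP=> ->; lia.
Qed.

Lemma eq_balls_from A C : balls_from A =1 balls_from C -> A = C.
Proof.
move=> eq_AC; apply/setP => j; have := eq_AC j.
by rewrite !balls_fromS eq_AC; case: (j \in A); case: (j \in C); lia.
Qed.

Lemma ord_downward_ind (P : nat -> Prop) :
  (forall k, n <= k -> P k) -> (forall j, P j.+1 -> P j) -> forall k, P k.
Proof.
move=> P_ge PS k; have [d] := ubnP (n - k); elim: d k => // d IHd k kd.
have [|kn] := leqP n k; first exact: P_ge.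
by apply: (PS (Ordinal kn)); apply: IHd => /=; lia.
Qed.

End SuffixCounts.

Section Domination.
Variable n : nat.
Implicit Types A C : {set 'I_n}.

Definition dominated A C := [forall j : 'I_n, balls_from A j <= balls_from C j].
Definition dominates C A := dominated A C.

Lemma dominatedP A C :
  reflect (forall k, balls_from A k <= balls_from C k) (dominated A C).
Proof.
apply: (iffP forallP) => [le_AC k|le_AC j]; last exact: le_AC.
have [kn|nk] := ltnP k n; first exact: (le_AC (Ordinal kn)).
by rewrite !balls_from_oversize.
Qed.

Lemma dominated_card A C : dominated A C -> #|A| <= #|C|.
Proof. by move/dominatedP/(_ 0); rewrite !balls_from0. Qed.

Lemma dominated_trans : transitive dominated.
Proof.
move=> C A E /dominatedP le_AC /dominatedP le_CE; apply/dominatedP => k.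
exact: leq_trans (le_AC k) (le_CE k).
Qed.

Lemma dominates_trans : transitive dominates.
Proof. exact: rev_trans dominated_trans. Qed.

Lemma dominated0 A : dominated set0 A.
Proof. by apply/dominatedP => k; rewrite balls_from_set0. Qed.

Lemma subset_dominated A C : A \subset C -> dominated A C.
Proof.
by move=> sAC; apply/dominatedP => k; rewrite -(balls_from_setD k sAC) leq_addl.
Qed.

End Domination.

(** * Unmatched balls of two consecutive rows *)

Section BracketMatching.
Variable n : nat.
Implicit Types (A C E U V : {set 'I_n}) (j : 'I_n) (st : seq 'I_n) (k m : nat).

(* The letters of the upper row A are "(", those of the lower row C are ")";
   a column is read from top to bottom. *)
Definition scan_step A C st j :=
  let opened := if j \in A then j :: st else st in
  if j \in C then behead opened else opened.

Definition unmatched A C : {set 'I_n} :=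
  [set j | j \in foldl (scan_step A C) [::] (enum 'I_n)].

Definition is_unmatched A C U :=
  [/\ U \subset A, [disjoint C & U],
      forall k, balls_from A k <= balls_from C k + balls_from U k &
      {in U, forall j, balls_from A j = balls_from C j + balls_from U j}].

Lemma ord_gt_trans : transitive (fun x y : 'I_n => y < x).
Proof. by move=> y x z /= yx zy; apply: ltn_trans zy yx. Qed.

Definition scan_invariant A C m st :=
  [/\ sorted (fun x y : 'I_n => y < x) st,
      {in st, forall x : 'I_n, [&& x < m, x \in A & x \notin C]},
      forall k, balls_in A k m <=
                balls_in C k m + count (fun x : 'I_n => k <= x) st &
      {in st, forall x : 'I_n, balls_in A x m =
                balls_in C x m + count (fun y : 'I_n => x <= y) st}].

Lemma scan_invariant_open A C j st : j \in A -> j \notin C ->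
  scan_invariant A C j st -> scan_invariant A C j.+1 (j :: st).
Proof.
move=> jA jC [sorted_st mem_st le_st eq_st]; split=> /=.
- case: st sorted_st mem_st {le_st eq_st} => //= x st -> mem_st.
  by rewrite andbT; case/and3P: (mem_st x (mem_head _ _)).
- move=> x /predU1P[->|/mem_st/and3P[xj -> ->]]; first by rewrite ltnSn jA.
  by rewrite ltnS ltnW.
- by move=> k; rewrite !balls_inS jA (negbTE jC); have := le_st k; lia.
move=> x /predU1P[->|x_st]; rewrite !balls_inS jA (negbTE jC) /=; last first.
  by rewrite (eq_st x x_st) addnCA.
rewrite !balls_in_empty // leqnn.
suff -> : count (fun y : 'I_n => j <= y) st = 0 by [].
apply/eqP; rewrite eqn0Ngt -has_count; apply/hasPn => y /mem_st/and3P[yj _ _].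
by rewrite -ltnNge.
Qed.

Lemma scan_invariant_close A C j st : j \notin A -> j \in C ->
  scan_invariant A C j st -> scan_invariant A C j.+1 (behead st).
Proof.
move=> jA jC [sorted_st mem_st le_st eq_st].
have count_behead k :
    count (fun x : 'I_n => k <= x) st <=
      (k <= j) + count (fun x : 'I_n => k <= x) (behead st).
  case: st mem_st {sorted_st le_st eq_st} => //= x st mem_st.
  by have /and3P[xj _ _] := mem_st x (mem_head _ _); lia.
split=> [|x x_st|k|x x_st].
- by case: (st) sorted_st => //= x s /path_sorted.
- by have /and3P[xj -> ->] := mem_st x (mem_behead x_st); rewrite ltnS ltnW.
- rewrite !balls_inS (negbTE jA) jC.
  by have := le_st k; have := count_behead k; lia.
rewrite !balls_inS (negbTE jA) jC (eq_st x (mem_behead x_st)) add0n.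
case: st x_st sorted_st mem_st {le_st eq_st count_behead} => //= t st x_st.
rewrite (path_sortedE ord_gt_trans) => /andP[/allP/(_ x x_st) xt _].
move/(_ t (mem_head _ _))=> /and3P[tj _ _].
by rewrite (ltnW xt) (ltnW (ltn_trans xt tj)) addnCA addnA.
Qed.

Lemma scan_invariant_skip A C j st : (j \in A) = (j \in C) ->
  scan_invariant A C j st -> scan_invariant A C j.+1 st.
Proof.
move=> jAC [sorted_st mem_st le_st eq_st]; split=> // [x x_st|k|x x_st].
- by have /and3P[xj -> ->] := mem_st x x_st; rewrite ltnS ltnW.
- by rewrite !balls_inS jAC -addnA leq_add2l.
- by rewrite !balls_inS jAC -addnA eq_st.
Qed.

Lemma scan_invariantS A C j st :
  scan_invariant A C j st -> scan_invariant A C j.+1 (scan_step A C st j).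
Proof.
rewrite /scan_step.
have [jA|jA] := boolP (j \in A); have [jC|jC] := boolP (j \in C).
- by apply: scan_invariant_skip; rewrite jA jC.
- exact: scan_invariant_open.
- exact: scan_invariant_close.
- by apply: scan_invariant_skip; rewrite (negbTE jA) (negbTE jC).
Qed.

Lemma unmatchedP A C : is_unmatched A C (unmatched A C).
Proof.
rewrite /unmatched; set st := foldl _ _ _.
have [sorted_st mem_st le_st eq_st] : scan_invariant A C n st.
  apply: foldl_enum_ord_ind => [|j st']; last exact: scan_invariantS.
  by split=> // k; rewrite balls_in_empty.
have uniq_st : uniq st.
  by apply: (sorted_uniq ord_gt_trans) sorted_st => x; apply: ltnn.
have balls_from_st k :
    balls_from [set j in st] k = count (fun x : 'I_n => k <= x) st.
  rewrite -size_filter -(card_uniqP (filter_uniq _ uniq_st)).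
  by apply: eq_card => x; rewrite !inE mem_filter ltn_ord andbT andbC.
split.
- by apply/subsetP => j; rewrite inE => /mem_st/and3P[].
- rewrite disjoint_sym disjoint_subset; apply/subsetP => j.
  by rewrite inE => /mem_st/and3P[].
- by move=> k; rewrite balls_from_st; apply: le_st.
- by move=> j; rewrite inE => j_st; rewrite balls_from_st; apply: eq_st.
Qed.

Lemma is_unmatched_inj A C U V :
  is_unmatched A C U -> is_unmatched A C V -> U = V.
Proof.
case=> _ _ le_U eq_U [_ _ le_V eq_V]; apply: eq_balls_from.
apply: (ord_downward_ind (n := n)) => [k nk|j IHj].
  by rewrite !balls_from_oversize.
have [jU|jU] := boolP (j \in U); have [jV|jV] := boolP (j \in V).
- by rewrite !balls_fromS jU jV IHj.
- move: (eq_U j jU) (le_V j).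
  by rewrite (balls_fromS U) (balls_fromS V) jU (negbTE jV) IHj; lia.
- move: (le_U j) (eq_V j jV).
  by rewrite (balls_fromS U) (balls_fromS V) (negbTE jU) jV IHj; lia.
- by rewrite !balls_fromS (negbTE jU) (negbTE jV) IHj.
Qed.

Lemma unmatchedE A C U : is_unmatched A C U -> unmatched A C = U.
Proof. exact/is_unmatched_inj/unmatchedP. Qed.

Lemma unmatched_sub A C : unmatched A C \subset A.
Proof. by case: (unmatchedP A C). Qed.

Lemma unmatched_disjoint A C : [disjoint C & unmatched A C].
Proof. by case: (unmatchedP A C). Qed.

Lemma balls_from_le_unmatched A C k :
  balls_from A k <= balls_from C k + balls_from (unmatched A C) k.
Proof. by case: (unmatchedP A C). Qed.

Lemma balls_from_setD_unmatched A C k :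
  balls_from (A :\: unmatched A C) k + balls_from (unmatched A C) k =
  balls_from A k.
Proof. exact/balls_from_setD/unmatched_sub. Qed.

Lemma balls_from_setU_unmatched A C k :
  balls_from (C :|: unmatched A C) k =
  balls_from C k + balls_from (unmatched A C) k.
Proof. exact/balls_from_setU/unmatched_disjoint. Qed.

Lemma card_setD_unmatched A C :
  #|A :\: unmatched A C| + #|unmatched A C| = #|A|.
Proof. by rewrite -!balls_from0 balls_from_setD_unmatched. Qed.

Lemma card_setU_unmatched A C :
  #|C :|: unmatched A C| = #|C| + #|unmatched A C|.
Proof. by rewrite -!balls_from0 balls_from_setU_unmatched. Qed.

Lemma dominated_unmatched A C :
  dominated (A :\: unmatched A C) (C :|: unmatched A C).
Proof.
apply/dominatedP => k; rewrite balls_from_setU_unmatched.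
have := balls_from_setD_unmatched A C k; have := balls_from_le_unmatched A C k.
lia.
Qed.

Lemma balls_from_unmatched_le A C k v :
  (forall i, k <= i -> balls_from A i <= balls_from C i + v) ->
  balls_from (unmatched A C) k <= v.
Proof.
have [_ _ _ eq_U] := unmatchedP A C; move: k.
apply: (ord_downward_ind (n := n)) => [k nk _|j IHj le_AC].
  by rewrite balls_from_oversize.
have [jU|jU] := boolP (j \in unmatched A C).
  by have := le_AC j (leqnn j); rewrite (eq_U j jU) leq_add2l.
by rewrite balls_fromS (negbTE jU); apply: IHj => i ji; apply/le_AC/ltnW.
Qed.

Lemma balls_from_unmatched_cascade A C E k : dominated C E ->
  balls_from (unmatched (C :|: unmatched A C) E) k <=
  balls_from (unmatched A C) k.
Proof.
move=> /dominatedP le_CE; apply: balls_from_unmatched_le => i ki.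
rewrite balls_from_setU_unmatched.
by have := le_CE i; have := leq_balls_from (unmatched A C) ki; lia.
Qed.

(* Pushing the surplus of the middle row down does not spoil the domination
   that has just been created above it. *)
Lemma dominated_unmatched_cascade A C E : dominated C E ->
  dominated (A :\: unmatched A C)
    ((C :|: unmatched A C) :\: unmatched (C :|: unmatched A C) E).
Proof.
move=> dom_CE; apply/dominatedP => k.
have := balls_from_unmatched_cascade A k dom_CE.
have := balls_from_setD_unmatched (C :|: unmatched A C) E k.
have := balls_from_setD_unmatched A C k; have := balls_from_le_unmatched A C k.
rewrite balls_from_setU_unmatched; lia.
Qed.

End BracketMatching.

Section Lifting.
Variables (n : nat) (P X : {set 'I_n}) (u : nat).
Implicit Types (k : nat) (j : 'I_n).

Definition surplus k := balls_from X k - balls_from P k.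

Fixpoint lifted_from k :=
  if k is k'.+1 then minn (lifted_from k') (surplus k) else u.

(* The u rightmost balls of X that may have dropped there from a row whose
   remaining balls form P; [lifted_from k] counts them in the columns >= k. *)
Definition lifted : {set 'I_n} :=
  [set j : 'I_n | lifted_from j.+1 < lifted_from j].

Lemma leq_lifted_from k v :
  (forall i, v i.+1 <= v i) -> (forall i, v i <= surplus i) -> v 0 <= u ->
  v k <= lifted_from k.
Proof.
move=> v_mono v_surplus v0; elim: k => //= k IHk.
by rewrite leq_min v_surplus (leq_trans (v_mono k)).
Qed.

Hypotheses (dom_PX : dominated P X) (u_PX : u + #|P| <= #|X|).

Lemma surplusK k : surplus k + balls_from P k = balls_from X k.
Proof. exact/subnK/dominatedP. Qed.

Lemma lifted_from_surplus k : lifted_from k <= surplus k.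
Proof.
case: k => [|k]; last exact: geq_minr.
by rewrite /surplus !balls_from0 leq_subRL 1?addnC // dominated_card.
Qed.

Lemma lifted_fromS j : lifted_from j = (j \in lifted) + lifted_from j.+1.
Proof.
have := surplusK j; have := surplusK j.+1; have := lifted_from_surplus j.
rewrite inE /= !(balls_fromS _ j).
by case: (j \in X); case: (j \in P) => /=; lia.
Qed.

Lemma mem_lifted j :
  j \in lifted -> [/\ j \in X, j \notin P & lifted_from j = surplus j].
Proof.
have := surplusK j; have := surplusK j.+1; have := lifted_from_surplus j.
rewrite inE /= !(balls_fromS _ j).
by case: (j \in X); case: (j \in P) => /= ? ? ? ?; split; lia.
Qed.

Lemma balls_from_lifted k : balls_from lifted k = lifted_from k.
Proof.
move: k; apply: (ord_downward_ind (n := n)) => [k nk|j IHj].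
  rewrite balls_from_oversize //; apply/esym/eqP; rewrite -leqn0.
  apply: leq_trans (lifted_from_surplus k) _.
  by rewrite /surplus !balls_from_oversize.
by rewrite balls_fromS IHj -lifted_fromS.
Qed.

Lemma card_lifted : #|lifted| = u.
Proof. by rewrite -balls_from0 balls_from_lifted. Qed.

Lemma lifted_sub : lifted \subset X.
Proof. by apply/subsetP => j /mem_lifted[]. Qed.

Lemma lifted_disjoint : [disjoint P & lifted].
Proof.
rewrite disjoint_sym disjoint_subset; apply/subsetP => j.
by case/mem_lifted.
Qed.

Lemma unmatched_lifted : unmatched (P :|: lifted) (X :\: lifted) = lifted.
Proof.
have sum_upper k := balls_from_setU k lifted_disjoint.
have sum_lower k := balls_from_setD k lifted_sub.
apply: unmatchedE; split.
- exact: subsetUr.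
- by rewrite disjoints_subset subsetDr.
- move=> k; rewrite sum_upper sum_lower -surplusK addnC leq_add2r.
  by rewrite balls_from_lifted lifted_from_surplus.
move=> j /mem_lifted[_ _ lifted_j].
by rewrite sum_upper sum_lower -surplusK -lifted_j -balls_from_lifted addnC.
Qed.

End Lifting.

Lemma lifted_from_unmatched n (A C : {set 'I_n}) k :
  lifted_from (A :\: unmatched A C) (C :|: unmatched A C) #|unmatched A C| k =
  balls_from (unmatched A C) k.
Proof.
set U := unmatched A C; set P := A :\: U; set X := C :|: U.
have [UA CU le_AC eq_AC] : is_unmatched A C U by apply: unmatchedP.
have upper i : balls_from P i + balls_from U i = balls_from A i.
  exact: balls_from_setD_unmatched.
have lower i : balls_from X i = balls_from C i + balls_from U i.
  exact: balls_from_setU_unmatched.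
elim: k => [|k IHk]; first by rewrite balls_from0.
rewrite /= IHk /surplus; have [nk|kn] := leqP n k.
  by rewrite !(balls_from_oversize _ (leqW nk)) minn0.
pose j := Ordinal kn; rewrite -[k]/(nat_of_ord j) (balls_fromS U).
have := upper j.+1; have := lower j.+1; have := le_AC j.+1.
have [jU|_] := boolP (j \in U); last by lia.
have jP : j \in P = false by rewrite in_setD jU.
have jX : j \in X by rewrite in_setU jU orbT.
have := upper j; have := lower j; have := eq_AC j jU.
rewrite !balls_fromS jU jP jX (subsetP UA j jU) (disjointFl CU jU); lia.
Qed.

Lemma lifted_unmatched n (A C : {set 'I_n}) :
  lifted (A :\: unmatched A C) (C :|: unmatched A C) #|unmatched A C| =
  unmatched A C.
Proof.
apply/setP => j; rewrite inE !lifted_from_unmatched (balls_fromS _ j).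
by rewrite -[ltnLHS]add0n ltn_add2r lt0b.
Qed.

(** * Row insertion *)

Section Interlacing.
Implicit Types s t : seq nat.

(* Both sequences are weakly increasing: they list the row sizes from top to
   bottom. *)
Fixpoint interlace s t : bool :=
  if t is y :: t' then
    [&& head 0 s <= y, y <= head 0 (behead s) & interlace (behead s) t']
  else size s == 1.

Lemma size_interlace s t : interlace s t -> size s = (size t).+1.
Proof.
elim: t s => [|y t IHt] [|x s] //=; first by move/eqP.
  by case/andP=> _ /IHt.
by case/and3P=> _ _ /IHt ->.
Qed.

Lemma interlaceP s t : interlace s t <->
  size s = (size t).+1 /\
  forall i, i < size t -> nth 0 s i <= nth 0 t i <= nth 0 s i.+1.
Proof.
elim: t s => [|y t IHt] s /=; first by split=> [/eqP ->|[->]].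
case: s => [|x s] /=; first by split=> [/andP[_ /IHt[]]|[]].
rewrite -nth0; split=> [/and3P[xy ys /IHt[-> st]]|[[size_s] st]].
  by split=> // -[_|i it]; [rewrite /= xy | apply: st].
have /andP[-> ->] := st 0 (ltn0Sn _); apply/IHt; split=> // i it.
exact: (st i.+1).
Qed.

Lemma interlace_revP s t : interlace (rev s) (rev t) <->
  size s = (size t).+1 /\
  forall r, nth 0 s r.+1 <= nth 0 t r <= nth 0 s r.
Proof.
rewrite interlaceP !size_rev; split=> -[size_s st]; split=> // r.
  have [rt|tr] := ltnP r (size t); last first.
    by rewrite (nth_default 0 tr) (nth_default 0 (n := r.+1)) ?size_s.
  have := st (size t - r.+1); rewrite !nth_rev ?size_s; try lia.
  have -> : size t - (size t - r.+1).+1 = r by lia.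
  have -> : (size t).+1 - (size t - r.+1).+1 = r.+1 by lia.
  have -> : (size t).+1 - (size t - r.+1).+2 = r by lia.
  by apply; lia.
move=> rt; rewrite !nth_rev ?size_s; try lia.
have -> : (size t).+1 - r.+1 = (size t - r.+1).+1 by lia.
have -> : (size t).+1 - r.+2 = size t - r.+1 by lia.
exact: st.
Qed.

End Interlacing.

Section RowSizes.
Variable n : nat.
Implicit Type M : seq {set 'I_n}.

Definition row_sizes M : seq nat := [seq #|Z| | Z : {set 'I_n} <- M].

Lemma size_row_sizes M : size (row_sizes M) = size M.
Proof. exact: size_map. Qed.

Lemma nth_row_sizes M r : nth 0 (row_sizes M) r = #|nth set0 M r|.
Proof.
have [rM|Mr] := ltnP r (size M); first exact: nth_map.
by rewrite !nth_default ?size_row_sizes // cards0.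
Qed.

Lemma mem0_row_sizes M : (0 \in row_sizes M) = (set0 \in M).
Proof.
apply/mapP/idP => [[Z ZM /esym/cards0_eq <-] //|M0].
by exists set0; rewrite ?cards0.
Qed.

Lemma row_sizes_rev M : row_sizes (rev M) = rev (row_sizes M).
Proof. exact: map_rev. Qed.

Lemma sorted_row_sizes M :
  sorted (@dominates n) M -> sorted geq (row_sizes M).
Proof. by rewrite sorted_map; apply: sub_sorted => C A /= /dominated_card. Qed.

End RowSizes.

Section RowInsertion.
Variable n : nat.
Implicit Types (S X : {set 'I_n}) (N P : seq {set 'I_n}) (s : seq nat).

(* The rows are listed from top to bottom: inserting S on top of N applies
   e*_k, ..., e*_1 successively. *)
Fixpoint insert_row S N : seq {set 'I_n} :=
  if N is C :: N'
  then (S :\: unmatched S C) :: insert_row (C :|: unmatched S C) N'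
  else [:: S].

Lemma size_insert_row S N : size (insert_row S N) = (size N).+1.
Proof. by elim: N S => //= C N IHN S; rewrite IHN. Qed.

Lemma head_insert_row_sub S N : head set0 (insert_row S N) \subset S.
Proof. by case: N => //= C N; apply: subsetDl. Qed.

Lemma sorted_insert_row S N :
  sorted (@dominated n) N -> sorted (@dominated n) (insert_row S N).
Proof.
elim: N S => //= C N IHN S path_N.
have := IHN (C :|: unmatched S C) (path_sorted path_N).
case: N path_N {IHN} => [|E N] /=; first by rewrite dominated_unmatched.
by case/andP=> dom_CE _ ->; rewrite dominated_unmatched_cascade.
Qed.

Lemma interlace_insert_row S N : sorted (@dominated n) N ->
  interlace (row_sizes (insert_row S N)) (row_sizes N).
Proof.
elim: N S => //= C N IHN S path_N; apply/and3P; split.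
- rewrite -!balls_from0.
  have := balls_from_le_unmatched S C 0.
  by have := balls_from_setD_unmatched S C 0; lia.
- case: N path_N {IHN} => [|E N]; rewrite /row_sizes /=.
    by rewrite card_setU_unmatched leq_addr.
  case/andP=> dom_CE _; have := balls_from_unmatched_cascade S 0 dom_CE.
  rewrite !balls_from0; have := card_setD_unmatched (C :|: unmatched S C) E.
  by rewrite card_setU_unmatched => /=; lia.
exact/IHN/(path_sorted path_N).
Qed.

(* The sizes of the remaining rows are prescribed by s: since the lower row
   keeps y balls, #|X| - y of the balls of X come from the row above. *)
Fixpoint extract_row P s : {set 'I_n} * seq {set 'I_n} :=
  match P, s with
  | P0 :: P', y :: s' =>
      let: (X, N) := extract_row P' s' in
      let U := lifted P0 X (#|X| - y) in (P0 :|: U, (X :\: U) :: N)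
  | _, _ => (head set0 P, [::])
  end.

Lemma insert_rowK S N : extract_row (insert_row S N) (row_sizes N) = (S, N).
Proof.
elim: N S => //= C N IHN S; rewrite IHN card_setU_unmatched addKn.
by rewrite lifted_unmatched setDUK ?unmatched_sub // setUDK ?unmatched_disjoint.
Qed.

Lemma dominated_setD_lifted (P0 X E : {set 'I_n}) u :
  dominated P0 (X :\: unmatched X E) -> u + #|P0| <= #|X| ->
  #|unmatched X E| <= u -> dominated (X :\: lifted P0 X u) E.
Proof.
move=> dom_P0 u_P0X unm_u.
have dom_P0X : dominated P0 X.
  by apply: dominated_trans dom_P0 (subset_dominated (subsetDl _ _)).
apply/dominatedP => k; have := balls_from_setD k (lifted_sub dom_P0X u_P0X).
suff : balls_from (unmatched X E) k <= balls_from (lifted P0 X u) k.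
  by have := balls_from_le_unmatched X E k; lia.
rewrite balls_from_lifted //; apply: leq_lifted_from => [i|i|].
- exact: leq_balls_from.
- rewrite /surplus -(balls_from_setD_unmatched X E i).
  by rewrite addnC -addnBA ?leq_addr //; apply/dominatedP.
- by rewrite balls_from0.
Qed.

Lemma extract_rowK P s : sorted (@dominated n) P -> interlace (row_sizes P) s ->
  [/\ insert_row (extract_row P s).1 (extract_row P s).2 = P,
      row_sizes (extract_row P s).2 = s &
      sorted (@dominated n) (extract_row P s).2].
Proof.
elim: P s => [|P0 P IHP] [|y s] //.
- by move=> _ /size_interlace.
- by case: P {IHP}.
move=> path_P /= /and3P[P0_y y_P /(IHP s (path_sorted path_P))[]].
case: (extract_row P s) => X N /= insert_XN sizes_N sorted_N.
have head_sub : head set0 P \subset X.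
  by rewrite -insert_XN head_insert_row_sub.
have head_size : head 0 (row_sizes P) = #|head set0 P|.
  by rewrite -insert_XN; case: (N).
have dom_P0_head : dominated P0 (head set0 P).
  by rewrite -insert_XN in path_P *; case: (N) path_P => [|E N'] /= /andP[].
have y_X : y <= #|X|.
  by apply: leq_trans (subset_leq_card head_sub); rewrite -head_size.
have lift_P0 : #|X| - y + #|P0| <= #|X|.
  by rewrite -[leqRHS](subnK y_X) leq_add2l.
have dom_P0X : dominated P0 X.
  by apply: dominated_trans dom_P0_head (subset_dominated head_sub).
have UX := lifted_sub dom_P0X lift_P0.
have P0U := lifted_disjoint dom_P0X lift_P0.
split.
- by rewrite unmatched_lifted // setUDK // setDUK // insert_XN.
- by rewrite sizes_N cardsDS // card_lifted // subKn.
case: N sorted_N insert_XN {sizes_N} => //= E N -> insert_XN; rewrite andbT.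
rewrite -insert_XN /= in dom_P0_head y_P; apply: dominated_setD_lifted => //.
by rewrite leq_subRL // -(card_setD_unmatched X E) leq_add2r.
Qed.

End RowInsertion.

Section InsertRows.
Variable n : nat.
Implicit Types (S : {set 'I_n}) (B P : seq {set 'I_n}) (i : nat).

Definition insert_rows B := foldl (fun N S => insert_row S N) [::] B.

Lemma insert_rows_rcons B S :
  insert_rows (rcons B S) = insert_row S (insert_rows B).
Proof. exact: foldl_rcons. Qed.

Lemma size_insert_rows B : size (insert_rows B) = size B.
Proof.
elim/last_ind: B => // B S IHB.
by rewrite insert_rows_rcons size_insert_row IHB size_rcons.
Qed.

Lemma sorted_insert_rows B : sorted (@dominated n) (insert_rows B).
Proof.
by elim/last_ind: B => // B S IHB; rewrite insert_rows_rcons sorted_insert_row.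
Qed.

Definition shape_at B i : seq nat := row_sizes (rev (insert_rows (take i B))).

Lemma size_shape_at B i : i <= size B -> size (shape_at B i) = i.
Proof.
by move=> iB; rewrite size_row_sizes size_rev size_insert_rows size_takel.
Qed.

Lemma shape_at_interlace B i r : i < size B ->
  nth 0 (shape_at B i.+1) r.+1 <= nth 0 (shape_at B i) r
    <= nth 0 (shape_at B i.+1) r.
Proof.
move=> iB; suff: interlace (rev (shape_at B i.+1)) (rev (shape_at B i)).
  by case/interlace_revP.
rewrite /shape_at !row_sizes_rev !revK (take_nth set0) // insert_rows_rcons.
exact/interlace_insert_row/sorted_insert_rows.
Qed.

Lemma shape_at_rcons B S i :
  i <= size B -> shape_at (rcons B S) i = shape_at B i.
Proof. by move=> iB; rewrite /shape_at -cats1 takel_cat. Qed.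

Lemma insert_rows_inj B1 B2 :
  size B1 = size B2 -> insert_rows B1 = insert_rows B2 ->
  (forall i, i <= size B1 -> shape_at B1 i = shape_at B2 i) -> B1 = B2.
Proof.
elim/last_ind: B1 B2 => [|B1 S1 IHB] B2; first by case: B2.
case/lastP: B2 => [|B2 S2]; rewrite !size_rcons // => -[eq_size].
rewrite !insert_rows_rcons => eq_insert eq_shape.
have {}eq_shape i : i <= size B1 -> shape_at B1 i = shape_at B2 i.
  by move=> iB; have := eq_shape i (leqW iB); rewrite !shape_at_rcons -?eq_size.
have eq_sizes : row_sizes (insert_rows B1) = row_sizes (insert_rows B2).
  have := eq_shape _ (leqnn _); rewrite /shape_at {2}eq_size !take_size.
  by rewrite !row_sizes_rev => /(can_inj revK).
have := insert_rowK S1 (insert_rows B1).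
rewrite eq_insert eq_sizes insert_rowK => -[-> eq_rows].
by rewrite (IHB B2).
Qed.

Lemma insert_rows_surj P (shape : nat -> seq nat) :
  sorted (@dominates n) P -> shape (size P) = row_sizes P ->
  (forall i, i < size P -> interlace (rev (shape i.+1)) (rev (shape i))) ->
  exists2 B, rev (insert_rows B) = P &
    forall i, i <= size P -> shape_at B i = shape i.
Proof.
have [m] := ubnP (size P); elim: m P => // m IHm P.
case/lastP: P => [|P Z] sizeP sorted_P shapeP interlace_shape.
  by exists [::] => // i; rewrite leqn0 => /eqP ->; rewrite shapeP.
rewrite size_rcons in sizeP shapeP interlace_shape *.
have rev_P : sorted (@dominated n) (rev (rcons P Z)) by rewrite rev_sorted.
have [|] := extract_rowK rev_P (s := rev (shape (size P))).
  by rewrite row_sizes_rev -shapeP; apply: interlace_shape.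
case: extract_row => S N /= insert_SN sizes_N sorted_N.
have size_N : size N = size P.
  have := congr1 size insert_SN.
  by rewrite size_insert_row size_rev size_rcons => -[].
have [|||i iP|B insert_B shape_B] := IHm (rev N).
- by rewrite size_rev size_N.
- by rewrite rev_sorted.
- by rewrite size_rev row_sizes_rev size_N sizes_N revK.
- by apply: interlace_shape; rewrite ltnW // -size_N -(size_rev N).
have {}insert_B : insert_rows B = N by apply: (can_inj revK).
have size_B : size B = size P by rewrite -size_insert_rows insert_B.
exists (rcons B S) => [|i].
  by rewrite insert_rows_rcons insert_B insert_SN revK.
rewrite leq_eqVlt => /predU1P[->|iP]; last first.
  by rewrite shape_at_rcons ?size_B // shape_B // size_rev size_N.
rewrite /shape_at -size_B -(size_rcons B S) take_size insert_rows_rcons.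
by rewrite insert_B insert_SN revK size_rcons size_B shapeP.
Qed.

End InsertRows.

(** * Collapsing is row insertion *)

Section Collapse.
Variable n : nat.
Implicit Types (C S : {set 'I_n}) (j : 'I_n) (B N T : seq {set 'I_n}).

Lemma par_step_column B i j st m : 0 < i ->
  foldl (par_step i) st [seq (r, j) | r <- rev (iota 1 m) & j \in row B r] =
  if m < i then st
  else if m == i then if j \in row B i then behead st else st
  else scan_step (row B i.+1) (row B i) st j.
Proof.
move=> i_gt0; elim: m st => [|m IHm] st; first by rewrite i_gt0.
have -> : rev (iota 1 m.+1) = m.+1 :: rev (iota 1 m).
  by rewrite -[m.+1 in LHS]addn1 iotaD rev_cat add1n.
rewrite /=; have [m_lt|m_gt|m_eq] := ltngtP m.+1 i.
- have skip : par_step i st (m.+1, j) = st.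
    by rewrite /par_step /= !ifF //; lia.
  by case: ifP => _; rewrite /= IHm (ltnW m_lt) ?skip.
- have m_ge : (m < i) = false by lia.
  have [m_i|m_i] := eqVneq m i.
    subst m; rewrite /scan_step; case: ifP => _; rewrite /= IHm ltnn eqxx //.
    by rewrite /par_step /= eqxx.
  have skip : par_step i st (m.+1, j) = st.
    by rewrite /par_step /= !ifF //; lia.
  by case: ifP => _; rewrite /= IHm m_ge (negbTE m_i) ?skip.
subst i; case: ifP => _ /=; rewrite IHm ltnSn //.
by rewrite /par_step /= eqxx ifF //; lia.
Qed.

Lemma unmatched_colsE B i : 0 < i < size B ->
  [set j | j \in unmatched_cols i B] = unmatched (row B i.+1) (row B i).
Proof.
case/andP=> i_gt0 iB; rewrite /unmatched /unmatched_cols /cwp.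
rewrite (foldl_flatten_map (h := scan_step (row B i.+1) (row B i))) // => st j.
by rewrite par_step_column // ltnNge ltnW //= gtn_eqF.
Qed.

Lemma estar_cat B C S T :
  estar (size B).+1 (B ++ C :: S :: T) =
  B ++ (C :|: unmatched S C) :: (S :\: unmatched S C) :: T.
Proof.
set D := B ++ _.
have size_D : size D = size B + (size T).+2 by rewrite size_cat.
have row_C : row D (size B).+1 = C by rewrite /row nth_cat ltnn subnn.
have row_S : row D (size B).+2 = S by rewrite /row nth_cat ltnNge leqnSn subSnn.
rewrite /estar unmatched_colsE ?size_D ?row_C ?row_S; last by lia.
apply: (@eq_from_nth _ set0); first by rewrite size_mkseq size_cat.
move=> k; rewrite size_mkseq => kD; rewrite nth_mkseq // !eqSS /row /= !nth_cat.
have [kB|Bk] := ltnP k (size B); first by rewrite !ifF //; lia.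
have [d ->] : exists d, k = size B + d by exists (k - size B); lia.
rewrite addKn; case: d => [|[|d]]; first by rewrite addn0 eqxx.
  by rewrite addn1 eqxx ifF //; lia.
by rewrite !ifF //; lia.
Qed.

Lemma estar_int_insert_row N S T :
  estar_int (size N) (rev N ++ S :: T) = rev (insert_row S N) ++ T.
Proof.
elim: N S T => [|C N IHN] S T //=.
rewrite /estar_int -[(size N).+1]addn1 iotaD foldr_cat /= add1n.
rewrite rev_cons cat_rcons.
have := estar_cat (rev N) C S T; rewrite size_rev => ->.
by rewrite -/(estar_int _ _) IHN rev_cons cat_rcons.
Qed.

Lemma stageE k B : 0 < k <= size B ->
  stage k B = rev (insert_rows (take k B)) ++ drop k B.
Proof.
case: k => // k; rewrite /stage /=; elim: k => [|k IHk] kB.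
  by case: B kB => //= S B _; rewrite take0 drop0.
rewrite -(addn1 k) iotaD foldl_cat /= IHk ?(ltnW kB) // addn1 add1n.
rewrite (drop_nth set0) ?(take_nth set0 (n := k.+1)) // insert_rows_rcons.
by rewrite -estar_int_insert_row size_insert_rows size_takel // ltnW.
Qed.

Lemma rhoNE B : 0 < size B -> rhoN B = rev (insert_rows B).
Proof.
by move=> B_gt0; rewrite /rhoN stageE ?B_gt0 //= take_size drop_size cats0.
Qed.

Lemma size_rhoN B : 0 < size B -> size (rhoN B) = size B.
Proof. by move=> B_gt0; rewrite rhoNE // size_rev size_insert_rows. Qed.

Lemma sorted_rhoN B : 0 < size B -> sorted (@dominates n) (rhoN B).
Proof.
by move=> B_gt0; rewrite rhoNE // rev_sorted; apply: sorted_insert_rows.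
Qed.

Lemma row_sizes_rhoN B : 0 < size B -> row_sizes (rhoN B) = shape_at B (size B).
Proof. by move=> B_gt0; rewrite rhoNE // /shape_at take_size. Qed.

Lemma cntN_shape B i r :
  i <= size B -> cntN B i r.+1 = nth 0 (shape_at B i) r.
Proof.
move=> iB; rewrite /cntN; case: ifP => [/andP[i_gt0 ri]|i_r].
  rewrite stageE ?i_gt0 // nth_row_sizes /row nth_cat.
  by rewrite size_rev size_insert_rows size_takel // ri.
by rewrite nth_default // size_shape_at //; lia.
Qed.

Lemma weight_insert_row S N : weight (insert_row S N) = weight (S :: N).
Proof.
rewrite /weight; elim: N S => //= C N IHN S.
rewrite big_cons IHN !big_cons !GRing.mulrA; congr (_ * _)%R.
rewrite [in RHS](big_setID (unmatched S C)) (setIidPr (unmatched_sub S C)) /=.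
rewrite big_setU_disjoint ?unmatched_disjoint //=.
by rewrite GRing.mulrC -GRing.mulrA GRing.mulrC.
Qed.

Lemma weight_insert_rows B : weight (insert_rows B) = weight B.
Proof.
elim/last_ind: B => // B S IHB; rewrite insert_rows_rcons weight_insert_row.
rewrite /weight big_cons -/(weight (insert_rows B)) IHB.
by rewrite /weight -cats1 big_cat big_seq1 GRing.mulrC.
Qed.

Lemma weight_rhoN B : 0 < size B -> weight B = weight (rhoN B).
Proof.
move=> B_gt0; rewrite rhoNE // -weight_insert_rows /weight.
by apply: perm_big; rewrite perm_sym perm_rev.
Qed.

End Collapse.

(** * The major index *)

Section DominatedSequences.
Implicit Types (s t : seq nat) (c d : nat).

Definition seq_dominated s t :=
  forall k, count (leq k) s <= count (leq k) t.

Lemma seq_dominated_cons c d s t : d \in t -> c <= d ->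
  seq_dominated s (rem d t) -> seq_dominated (c :: s) t.
Proof.
move=> dt cd dom_s k; rewrite (permP (perm_to_rem dt)) /=.
by apply: leq_add (dom_s k); case: (leqP k c) => // /leq_trans ->.
Qed.

(* Matching c with the least available d >= c is optimal. *)
Lemma seq_dominated_rem c d s t :
  d \in t -> c <= d -> {in t, forall x, c <= x -> d <= x} ->
  seq_dominated (c :: s) t -> seq_dominated s (rem d t).
Proof.
move=> dt cd d_min dom_cs k; have count_t a := permP (perm_to_rem dt) a.
have := dom_cs k; rewrite count_t /=.
have [kc|ck] := leqP k c; first by rewrite (leq_trans kc cd) leq_add2l.
have [kd _|_] := leqP k d; last by [].
have -> : count (leq k) (rem d t) = count (leq c) (rem d t).
  apply: eq_in_count => x /mem_rem xt; apply/idP/idP => [|cx].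
    exact/leq_trans/ltnW.
  exact: leq_trans kd (d_min x xt cx).
have := dom_cs c; rewrite count_t /= leqnn cd leq_add2l.
by apply: leq_trans; apply: sub_count => x; apply/leq_trans/ltnW.
Qed.

End DominatedSequences.

Section CyclicScan.
Implicit Types (c d n : nat) (p : pred nat).

Lemma cyclic_iota n c : c < n ->
  [seq (c + k) %% n | k <- iota 0 n] = iota c (n - c) ++ iota 0 c.
Proof.
move=> cn; apply: (@eq_from_nth _ 0).
  by rewrite size_map size_cat !size_iota subnK // ltnW.
move=> i; rewrite size_map size_iota => i_n.
rewrite (nth_map 0) ?size_iota // nth_iota // nth_cat size_iota add0n.
case: ltnP => i_c; first by rewrite nth_iota // modn_small //; lia.
rewrite nth_iota; last by lia.
have -> : c + i = (c + i - n) + n by lia.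
by rewrite modnDr modn_small; lia.
Qed.

Lemma filter_iota_cons p a m d s : [seq x <- iota a m | p x] = d :: s ->
  [/\ p d, a <= d < a + m & forall x, a <= x < d -> ~~ p x].
Proof.
elim: m a => //= m IHm a; case: (boolP (p a)) => [pa [<- _]|Npa].
  by split=> // [|x]; lia.
case/IHm=> pd /andP[ad da] Np; split=> // [|x /andP[ax xd]].
  by rewrite ltnW // -addSnnS.
by move: ax; rewrite leq_eqVlt => /predU1P[<- //|ax]; apply: Np; rewrite ax.
Qed.

End CyclicScan.

Local Arguments pair_step : simpl never.
Local Arguments maj_step : simpl never.

Section Pairing.
Variables (n : nat) (lower : seq nat) (r : nat).
Hypotheses (uniq_lower : uniq lower) (lower_n : all (gtn n) lower).
Implicit Types (lab ps : seq (nat * nat)) (acc c d l : nat).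

Definition unlabelled lab := [seq d <- lower | d \notin map fst lab].

Lemma unlabelled_cons lab d l :
  unlabelled ((d, l) :: lab) = rem d (unlabelled lab).
Proof.
rewrite rem_filter ?filter_uniq // -filter_predI.
by apply: eq_filter => x /=; rewrite inE negb_or.
Qed.

Variant pair_step_spec lab acc c l : seq (nat * nat) * nat -> Prop :=
  | PairNone of unlabelled lab = [::] : pair_step_spec lab acc c l (lab, acc)
  | PairRight d of d \in unlabelled lab & c <= d
      & {in unlabelled lab, forall x, c <= x -> d <= x} :
      pair_step_spec lab acc c l ((d, l) :: lab, acc)
  | PairWrap d acc' of d \in unlabelled lab & acc < acc'
      & {in unlabelled lab, forall x, x < c} :
      pair_step_spec lab acc c l ((d, l) :: lab, acc').

Lemma pair_stepP lab acc c l : c < n ->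
  pair_step_spec lab acc c l (pair_step n lower r (lab, acc) (c, l)).
Proof.
move=> cn; rewrite /pair_step cyclic_iota //= filter_cat.
set p := fun d => _ && _.
have pE d : p d = (d \in unlabelled lab) by rewrite mem_filter andbC.
case right: (filter p (iota c (n - c))) => [|d s] /=; last first.
  have [pd /andP[cd _] Np] := filter_iota_cons right.
  rewrite (ltnNge d c) cd addn0; apply: PairRight; rewrite -?pE // => x.
  rewrite -pE => px cx; rewrite leqNgt; apply: contraL px => xd.
  by apply: Np; rewrite cx.
have lt_c x : x \in unlabelled lab -> x < c.
  move=> x_free; rewrite ltnNge; apply/negP => cx.
  have xn : x < n.
    by apply: (allP lower_n); move: x_free; rewrite mem_filter => /andP[].
  suff: x \in [::] by []; rewrite -right mem_filter pE x_free mem_iota; lia.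
case left: (filter p (iota 0 c)) => [|d s] /=.
  apply: PairNone; apply/nilP; rewrite /nilp size_filter eqn0Ngt -has_count.
  apply/hasPn => x x_lower; apply/negP => x_unlab.
  have x_free : x \in unlabelled lab by rewrite mem_filter x_unlab.
  suff: x \in [::] by [].
  by rewrite -left mem_filter pE x_free mem_iota /= lt_c.
have [pd /andP[_ dc] _] := filter_iota_cons left; rewrite add0n in dc.
by rewrite dc; apply: PairWrap => //; [rewrite -pE | lia].
Qed.

Lemma leq_pairing_acc lab acc ps :
  acc <= (foldl (pair_step n lower r) (lab, acc) ps).2.
Proof.
elim: ps lab acc => //= p ps IHps lab acc; rewrite {2}/pair_step.
case: filter => [|d s]; first exact: IHps.
exact: leq_trans (leq_addr _ _) (IHps _ _).
Qed.

Lemma pairing_labels_bound L lab acc ps :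
  all (fun q => q.2 <= L) lab -> all (fun q => q.2 <= L) ps ->
  all (fun q => q.2 <= L) (foldl (pair_step n lower r) (lab, acc) ps).1.
Proof.
elim: ps lab acc => //= p ps IHps lab acc lab_L /andP[p_L ps_L].
rewrite {2}/pair_step; case: filter => [|d s]; first exact: IHps.
by apply: IHps => //=; rewrite p_L.
Qed.

Lemma pairing_dominated_no_wrap lab acc ps : all (fun q => q.1 < n) ps ->
  seq_dominated (map fst ps) (unlabelled lab) ->
  (foldl (pair_step n lower r) (lab, acc) ps).2 = acc.
Proof.
elim: ps lab => //= -[c l] ps IHps lab /andP[/= cn ps_n] dom_cps.
have /hasP[x x_free cx] : has (leq c) (unlabelled lab).
  by rewrite has_count (leq_trans _ (dom_cps c)) //= leqnn.
case: pair_stepP => // [no_free|d d_free cd d_min|d acc' _ _ lt_c].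
- by rewrite no_free in x_free.
- apply: IHps => //; rewrite unlabelled_cons //.
  exact: seq_dominated_rem dom_cps.
- by have := lt_c x x_free; rewrite ltnNge cx.
Qed.

Lemma pairing_no_wrap_dominated lab acc ps : all (fun q => q.1 < n) ps ->
  size ps <= size (unlabelled lab) ->
  (foldl (pair_step n lower r) (lab, acc) ps).2 = acc ->
  seq_dominated (map fst ps) (unlabelled lab).
Proof.
elim: ps lab => [|[c l] ps IHps] lab; first by move=> _ _ _ k.
move=> /= /andP[cn ps_n] size_ps.
case: pair_stepP => // [no_free|d d_free cd _|d acc' _ acc_acc' _] no_wrap.
- by rewrite no_free in size_ps.
- apply: (seq_dominated_cons d_free cd); rewrite -(unlabelled_cons lab d l).
  apply: IHps no_wrap => //.
  rewrite unlabelled_cons // size_rem // -ltnS prednK //.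
  exact: leq_ltn_trans size_ps.
have := leq_pairing_acc ((d, l) :: lab) acc' ps.
by rewrite no_wrap leqNgt acc_acc'.
Qed.

End Pairing.

Lemma pairing_order_perm fl L :
  all (fun q => q.2 <= L) fl -> perm_eq (pairing_order fl L) fl.
Proof.
move=> fl_L; apply: perm_flatten_fibers; first by rewrite rev_uniq iota_uniq.
by apply: sub_all fl_L => q q_L; rewrite mem_rev mem_iota.
Qed.

Lemma full_labels_bound upper lab r L : r <= L -> all (fun q => q.2 <= L) lab ->
  all (fun q => q.2 <= L) (full_labels upper lab r).
Proof.
move=> rL /allP lab_L; apply/allP => _ /mapP[c _ ->] /=.
set labels := [seq q.2 | q <- _ & _].
have : all (geq L) labels.
  by apply/allP => _ /mapP[q + ->]; rewrite mem_filter => /andP[_ /lab_L].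
by case: labels => //= l s /andP[].
Qed.

Section MajorIndex.
Variable n : nat.
Implicit Types (M : seq {set 'I_n}) (lab : seq (nat * nat)) (acc r : nat).

Lemma rowN_uniq M r : uniq (rowN M r).
Proof. by rewrite map_inj_uniq; [exact: enum_uniq | exact: val_inj]. Qed.

Lemma rowN_lt M r : all (gtn n) (rowN M r).
Proof. by apply/allP => _ /mapP[j _ ->]; apply: ltn_ord. Qed.

Lemma count_rowN M r k : count (leq k) (rowN M r) = balls_from (row M r) k.
Proof.
rewrite count_map -size_filter /balls_from /balls_in.
rewrite -(card_uniqP (filter_uniq _ (enum_uniq _))); apply: eq_card => j.
by rewrite inE mem_filter mem_enum ltn_ord andbT andbC.
Qed.

Lemma seq_dominated_rowN M r r' :
  seq_dominated (rowN M r) (rowN M r') <-> dominated (row M r) (row M r').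
Proof.
by split=> [dom|/dominatedP dom k]; [apply/dominatedP => k; have := dom k|];
  rewrite !count_rowN.
Qed.

Lemma maj_step_stationary M lab acc r :
  r <= size M -> all (fun q => q.2 <= size M) lab ->
  #|row M r| <= #|row M r.-1| ->
  ((maj_step M (lab, acc) r).2 == acc) = dominated (row M r) (row M r.-1).
Proof.
move=> rM lab_M card_le; rewrite /maj_step.
set fl := full_labels _ _ _; set ps := pairing_order _ _.
have ps_fl : perm_eq ps fl by apply/pairing_order_perm/full_labels_bound.
have fst_fl : map fst fl = rowN M r by rewrite -map_comp map_id_in.
have fst_ps : perm_eq (map fst ps) (rowN M r) by rewrite -fst_fl perm_map.
have ps_n : all (fun q => q.1 < n) ps.
  by rewrite (perm_all _ ps_fl); have := rowN_lt M r; rewrite -fst_fl all_map.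
have all_free : unlabelled (rowN M r.-1) [::] = rowN M r.-1.
  by apply/all_filterP/allP.
have dom_ps : seq_dominated (map fst ps) (unlabelled (rowN M r.-1) [::]) <->
    dominated (row M r) (row M r.-1).
  rewrite all_free -seq_dominated_rowN.
  by split=> dom k; have := dom k; rewrite (permP fst_ps).
apply/eqP/idP => [no_wrap|/(iffRL dom_ps)].
  apply: (iffLR dom_ps); apply: pairing_no_wrap_dominated no_wrap => //.
  - exact: rowN_uniq.
  - exact: rowN_lt.
  by rewrite all_free -(size_map fst) (perm_size fst_ps) !size_map -!cardE.
apply: pairing_dominated_no_wrap => //; [exact: rowN_uniq | exact: rowN_lt].
Qed.

Lemma maj_step_labels_bound M lab acc r : r <= size M ->
  all (fun q => q.2 <= size M) lab ->
  all (fun q => q.2 <= size M) (maj_step M (lab, acc) r).1.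
Proof.
move=> rM lab_M; apply: pairing_labels_bound => //.
by rewrite (perm_all _ (pairing_order_perm _)); apply: full_labels_bound.
Qed.

Lemma leq_foldl_maj_step M st rs : st.2 <= (foldl (maj_step M) st rs).2.
Proof.
elim: rs st => //= r rs IHrs [lab acc]; apply: leq_trans _ (IHrs _).
exact: leq_pairing_acc.
Qed.

Lemma foldl_maj_step_stationary M lab acc rs :
  all (fun q => q.2 <= size M) lab -> all (geq (size M)) rs ->
  all (fun r => #|row M r| <= #|row M r.-1|) rs ->
  ((foldl (maj_step M) (lab, acc) rs).2 == acc) =
  all (fun r => dominated (row M r) (row M r.-1)) rs.
Proof.
elim: rs lab acc => [|r rs IHrs] lab acc /=; first by rewrite eqxx.
move=> lab_M /andP[rM rs_M] /andP[card_r card_rs].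
have := maj_step_labels_bound acc rM lab_M.
have := leq_foldl_maj_step M (lab, acc) [:: r].
rewrite -(maj_step_stationary acc rM lab_M card_r) /=.
case: (maj_step M (lab, acc) r) => lab' acc' /= acc_le lab'_M.
have [->|acc'_neq] := eqVneq acc' acc; first exact: IHrs.
have := leq_foldl_maj_step M (lab', acc') rs => /= acc'_le.
by apply: gtn_eqF; apply: leq_trans acc'_le; rewrite ltn_neqAle eq_sym acc'_neq.
Qed.

Lemma maj_eq0 M : sorted geq (row_sizes M) ->
  (maj M == 0) = sorted (@dominates n) M.
Proof.
move=> sorted_M; rewrite /maj foldl_maj_step_stationary //; last 2 first.
- by apply/allP => r; rewrite mem_rev mem_iota /=; lia.
- by apply/allP => r _; rewrite -!nth_row_sizes sorted_geq_nth // leq_pred.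
apply/allP/(sortedP set0) => [dom r rM|dom r].
  by have := dom r.+2; rewrite mem_rev mem_iota; apply; lia.
by rewrite mem_rev mem_iota; case: r => [|[|r]] // rM; apply: dom; lia.
Qed.

End MajorIndex.

(** * The recording tableau *)

Section IncrementWord.
Implicit Types (f : nat -> nat) (L k x : nat).

Definition increment_word f L : seq nat :=
  flatten [seq nseq (f i - f i.-1) i | i <- iota 1 L].

Lemma increment_wordS f L :
  increment_word f L.+1 = increment_word f L ++ nseq (f L.+1 - f L) L.+1.
Proof.
rewrite /increment_word -[X in iota _ X]addn1 iotaD map_cat flatten_cat /=.
by rewrite cats0.
Qed.

Lemma mem_increment_word f L x : x \in increment_word f L -> 0 < x <= L.
Proof.
case/flatten_mapP=> i; rewrite mem_iota mem_nseq add1n ltnS => i_L.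
by case/andP=> _ /eqP->.
Qed.

Lemma sorted_increment_word f L : sorted leq (increment_word f L).
Proof.
elim: L => // L IHL; rewrite increment_wordS.
rewrite sorted_pairwise; last exact: leq_trans.
rewrite pairwise_cat -!sorted_pairwise ?IHL; try exact: leq_trans.
apply/and3P; split=> //; last first.
  by case: (_ - _) => //= m; elim: m => //= m ->; rewrite leqnn.
apply/allrelP => x y /mem_increment_word/andP[_ xL].
by rewrite mem_nseq => /andP[_ /eqP->]; apply: leqW.
Qed.

Lemma count_increment_word f L k :
  f 0 = 0 -> (forall i, i < L -> f i <= f i.+1) -> k <= L ->
  count (leq^~ k) (increment_word f L) = f k.
Proof.
move=> f0; elim: L k => [|L IHL] k f_mono.
  by rewrite leqn0 => /eqP->.
have {}IHL i : i <= L -> count (leq^~ i) (increment_word f L) = f i.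
  by apply: IHL => j jL; apply/f_mono/leqW.
rewrite increment_wordS count_cat count_nseq leq_eqVlt.
case/predU1P=> [->|]; last first.
  by rewrite ltnS => kL; rewrite IHL // leqNgt ltnS kL addn0.
rewrite leqnn mul1n.
suff -> : count (leq^~ L.+1) (increment_word f L) = f L.
  by rewrite subnKC ?f_mono.
rewrite -(IHL L (leqnn L)); apply: eq_in_count => x.
by case/mem_increment_word/andP=> _ xL; rewrite xL leqW.
Qed.

Lemma size_increment_word f L :
  f 0 = 0 -> (forall i, i < L -> f i <= f i.+1) ->
  size (increment_word f L) = f L.
Proof.
move=> f0 f_mono; rewrite -(count_increment_word f0 f_mono (leqnn L)).
apply/esym/eqP; rewrite -all_count; apply/allP => x.
by case/mem_increment_word/andP.
Qed.

End IncrementWord.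

Section ColumnStrict.
Implicit Types s t : seq nat.

Lemma column_strict_countP L s t :
  sorted leq s -> sorted leq t -> {in t, forall x, 1 <= x <= L} ->
  size t <= size s ->
  (forall c, c < size t -> nth 0 s c < nth 0 t c) <->
  (forall i, i < L -> count (leq^~ i.+1) t <= count (leq^~ i) s).
Proof.
move=> sorted_s sorted_t t_L size_ts; split=> [lt_st i _|le_count c c_t].
  case count_t: (count _ t) => [//|c].
  have c_count : c < count (leq^~ i.+1) t by rewrite count_t.
  have c_t : c < size t := leq_trans c_count (count_size _ t).
  rewrite -nth_leq_count ?(leq_trans c_t size_ts) // -ltnS.
  by apply: leq_trans (lt_st c c_t) _; rewrite nth_leq_count.
have := t_L _ (mem_nth 0 c_t); case t_c: (nth 0 t c) => [//|y] /= yL.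
rewrite ltnS nth_leq_count ?(leq_trans c_t size_ts) //.
by apply: leq_trans (le_count y yL); rewrite -nth_leq_count ?t_c.
Qed.

End ColumnStrict.

Section Tableaux.
Variables (L : nat) (nu : seq nat) (Q : seq (seq nat)).
Hypotheses (sorted_nu : sorted geq nu) (SSYT_Q : is_SSYT nu L Q).
Implicit Types i r : nat.

Lemma SSYT_size_row r : size (nth [::] Q r) = nth 0 nu r.
Proof.
case: SSYT_Q => <- _ _ _; have [rQ|Qr] := ltnP r (size Q).
  by rewrite (nth_map [::]).
by rewrite !nth_default ?size_map.
Qed.

Lemma SSYT_count_strip i r : i < L ->
  count (leq^~ i.+1) (nth [::] Q r.+1) <= count (leq^~ i) (nth [::] Q r).
Proof.
case: SSYT_Q => _ sorted_Q Q_L strict_Q.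
move: i; apply/column_strict_countP => //; last exact: strict_Q.
  exact: Q_L.
by rewrite !SSYT_size_row sorted_geq_nth.
Qed.

Lemma SSYT_count0 i r : i <= r -> i <= L -> count (leq^~ i) (nth [::] Q r) = 0.
Proof.
elim: i r => [|i IHi] [|r] // ir iL.
1,2: apply/eqP; rewrite eqn0Ngt -has_count; apply/hasPn => x;
  by case: SSYT_Q => _ _ Q_L _ /Q_L/andP[x_gt0 _]; rewrite -ltnNge.
by apply/eqP; rewrite -leqn0 -(IHi r) ?SSYT_count_strip // ltnW.
Qed.

Lemma SSYT_count_max r : count (leq^~ L) (nth [::] Q r) = nth 0 nu r.
Proof.
rewrite -SSYT_size_row; apply/eqP; rewrite -all_count; apply/allP => x.
by case: SSYT_Q => _ _ Q_L _ /Q_L/andP[].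
Qed.

Lemma SSYT_height : 0 \notin nu -> size nu <= L.
Proof.
move=> nu0; rewrite leqNgt; apply: contra nu0 => L_nu.
by rewrite -(SSYT_count0 (leqnn L) (leqnn L)) SSYT_count_max mem_nth.
Qed.

(* Cut off at row i, above which strict columns leave no entry <= i. *)
Definition subtableau_shape i : seq nat :=
  mkseq (fun r => count (leq^~ i) (nth [::] Q r)) i.

Lemma nth_subtableau_shape i r : i <= L ->
  nth 0 (subtableau_shape i) r = count (leq^~ i) (nth [::] Q r).
Proof.
move=> iL; have [ri|ir] := ltnP r i; first by rewrite nth_mkseq.
by rewrite nth_default ?size_mkseq // SSYT_count0.
Qed.

Lemma interlace_subtableau_shape i : i < L ->
  interlace (rev (subtableau_shape i.+1)) (rev (subtableau_shape i)).
Proof.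
move=> iL; apply/interlace_revP; split=> [|r]; first by rewrite !size_mkseq.
rewrite !nth_subtableau_shape ?(ltnW iL) // SSYT_count_strip //=.
by apply: sub_count => x; apply: leqW.
Qed.

End Tableaux.

Section Recording.
Variable n : nat.
Implicit Types (B M : seq {set 'I_n}) (Q : seq (seq nat)) (i k r : nat).

Lemma leq_cntN B r i : i < size B -> cntN B i r.+1 <= cntN B i.+1 r.+1.
Proof.
move=> iB; rewrite !cntN_shape ?(ltnW iB) //.
by case/andP: (shape_at_interlace r iB).
Qed.

Lemma count_rhoQ_row B r k : k <= size B ->
  count (leq^~ k) (rhoQ_row B r.+1) = nth 0 (shape_at B k) r.
Proof.
move=> kB; rewrite -cntN_shape //.
apply: (count_increment_word (f := cntN B ^~ r.+1)) => // i.
exact: leq_cntN.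
Qed.

Lemma size_rhoQ_row B r : 0 < size B ->
  size (rhoQ_row B r.+1) = nth 0 (row_sizes (rhoN B)) r.
Proof.
move=> B_gt0; rewrite row_sizes_rhoN // -cntN_shape //.
apply: (size_increment_word (f := cntN B ^~ r.+1)) => // i.
exact: leq_cntN.
Qed.

Lemma nth_rhoQ_rows B r : 0 < size B ->
  nth [::] (mkseq (fun k => rhoQ_row B k.+1) (size B)) r = rhoQ_row B r.+1.
Proof.
move=> B_gt0; have [rB|Br] := ltnP r (size B); first by rewrite nth_mkseq.
rewrite nth_default ?size_mkseq //; apply/esym/size0nil.
by rewrite size_rhoQ_row // nth_default // size_row_sizes size_rhoN.
Qed.

Lemma nth_rhoQ B r : 0 < size B -> nth [::] (rhoQ B) r = rhoQ_row B r.+1.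
Proof.
by move=> B_gt0; rewrite nth_trim_top ?nth_rhoQ_rows // => s /nilP.
Qed.

Lemma size_rhoQ B : 0 < size B -> map size (rhoQ B) = row_sizes (rho B).1.
Proof.
move=> B_gt0; rewrite /row_sizes /=.
rewrite (map_trim_top (q := pred1 0)) // (map_trim_top (q := pred1 0)) => [|Z].
  congr trim_top; apply: (@eq_from_nth _ 0).
    by rewrite size_map size_mkseq size_row_sizes size_rhoN.
  move=> r; rewrite size_map size_mkseq => rB.
  by rewrite (nth_map [::]) ?size_mkseq // nth_rhoQ_rows // size_rhoQ_row.
by rewrite /= cards_eq0.
Qed.

Lemma rhoQ_SSYT B : 0 < size B ->
  is_SSYT (row_sizes (rho B).1) (size B) (rhoQ B).
Proof.
move=> B_gt0; have sorted_row r : sorted leq (rhoQ_row B r).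
  exact: sorted_increment_word.
have row_B r : {in rhoQ_row B r, forall x, 1 <= x <= size B}.
  by move=> x; apply: mem_increment_word.
split=> [|r|r x|r]; rewrite ?nth_rhoQ //; first exact: size_rhoQ.
  exact: row_B.
apply/(@column_strict_countP (size B)) => // [|i iB].
  rewrite !size_rhoQ_row // sorted_geq_nth //.
  exact/sorted_row_sizes/sorted_rhoN.
by rewrite !count_rhoQ_row ?(ltnW iB) //; case/andP: (shape_at_interlace r iB).
Qed.

Lemma in_targetP L M Q : in_target L (M, Q) <->
  [/\ sorted (@dominates n) M, set0 \notin M & is_SSYT (row_sizes M) L Q].
Proof.
split=> [[mu [/andP[/and3P[_ _ /eqP sizes_M] maj_M] SSYT_Q]]|].
  have /andP[sorted_mu pos_mu] := conj_part_partition mu.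
  move: maj_M SSYT_Q; rewrite /= -sizes_M -/(row_sizes M) in sorted_mu pos_mu *.
  rewrite maj_eq0 // => sorted_M SSYT_Q; split=> //.
  by rewrite -mem0_row_sizes; apply/negP => /(allP pos_mu).
case=> sorted_M M0 SSYT_Q; have sizes_M := sorted_row_sizes sorted_M.
have part_M : is_partition (row_sizes M).
  rewrite /is_partition sizes_M; apply/allP => m mM; rewrite lt0n.
  by apply: contraNneq M0 => m0; rewrite -mem0_row_sizes -m0.
exists (conj_part (row_sizes M)).
rewrite /in_MLQ0 /in_MLQ /= conj_partK // maj_eq0 // sorted_M.
rewrite conj_part_partition size_conj_part eqxx !andbT /=; split=> //.
by rewrite -nth0 nth_row_sizes -[leqRHS]card_ord max_card.
Qed.

Lemma rho_inj B1 B2 :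
  0 < size B1 -> size B1 = size B2 -> rho B1 = rho B2 -> B1 = B2.
Proof.
move=> B1_gt0 eq_size [eq_N eq_Q].
have B2_gt0 : 0 < size B2 by rewrite -eq_size.
have eq_insert : insert_rows B1 = insert_rows B2.
  apply: (can_inj revK); rewrite -!rhoNE //.
  by apply: (trim_top_inj (x0 := set0)) eq_N => [Z /eqP//|]; rewrite !size_rhoN.
apply: insert_rows_inj => // i iB1; have iB2 : i <= size B2 by rewrite -eq_size.
apply: (@eq_from_nth _ 0) => [|r _]; first by rewrite !size_shape_at.
by rewrite -!count_rhoQ_row // -!nth_rhoQ // eq_Q.
Qed.

Lemma rho_in_target B : 0 < size B -> in_target (size B) (rho B).
Proof.
move=> B_gt0; apply/in_targetP; have sorted_N := sorted_rhoN B_gt0.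
have eq0_up (C A : {set 'I_n}) : dominates C A -> C == set0 -> A == set0.
  by move=> /dominated_card + /eqP C0; rewrite C0 cards0 leqn0 cards_eq0.
have trim_N := trim_top_sorted (@dominates_trans n) eq0_up sorted_N.
split; last exact: rhoQ_SSYT.
  by rewrite trim_N; apply: sorted_filter sorted_N; apply: dominates_trans.
by rewrite trim_N mem_filter /= eqxx.
Qed.

Lemma shape_at_surj L M Q : sorted (@dominates n) M ->
  is_SSYT (row_sizes M) L Q ->
  exists2 B, rev (insert_rows B) = mkseq (nth set0 M) L &
    forall i, i <= L -> shape_at B i = subtableau_shape Q i.
Proof.
move=> sorted_M SSYT_Q; have sizes_M := sorted_row_sizes sorted_M.
set P := mkseq _ L; have size_P : size P = L by rewrite size_mkseq.
have sorted_P : sorted (@dominates n) P.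
  apply/(sortedP set0) => r; rewrite size_P => rL.
  rewrite !nth_mkseq ?(ltnW rL) //.
  have [rM|Mr] := ltnP r.+1 (size M); first exact: (sortedP set0 sorted_M).
  by rewrite (nth_default _ Mr) /dominates dominated0.
have [||B insert_B shape_B] :=
  insert_rows_surj (shape := subtableau_shape Q) sorted_P.
- rewrite size_P; apply: (@eq_from_nth _ 0).
    by rewrite size_mkseq size_row_sizes size_P.
  move=> r; rewrite size_mkseq => rL.
  rewrite (nth_subtableau_shape _ SSYT_Q) // (SSYT_count_max SSYT_Q).
  by rewrite !nth_row_sizes nth_mkseq.
- by move=> i; rewrite size_P; apply: (interlace_subtableau_shape _ SSYT_Q).
by exists B => // i; rewrite -size_P; apply: shape_B.
Qed.

Lemma rhoQ_SSYT_eq B nu Q : 0 < size B ->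
  sorted geq nu -> 0 \notin nu -> is_SSYT nu (size B) Q ->
  (forall i, i <= size B -> shape_at B i = subtableau_shape Q i) -> rhoQ B = Q.
Proof.
move=> B_gt0 sorted_nu nu0 SSYT_Q shape_B.
have [sizes_Q sorted_Q Q_B _] := SSYT_Q.
apply: (trim_top_eq (x0 := [::])) => // [|r].
  apply/allP => t tQ /=; apply: contra nu0 => /nilP t_nil.
  by rewrite -sizes_Q -[0]/(size (Nil nat)) -t_nil map_f.
rewrite nth_rhoQ_rows //; apply: (@eq_sorted_count_leq (size B)) => //.
- exact: sorted_increment_word.
- by apply/allP => x /mem_increment_word/andP[].
- by apply/allP => x /Q_B/andP[].
move=> k kB; rewrite count_rhoQ_row // shape_B //.
exact: (nth_subtableau_shape sorted_nu SSYT_Q).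
Qed.

Lemma rho_surj L (p : seq {set 'I_n} * seq (seq nat)) :
  0 < L -> in_target L p -> exists2 B, size B = L & rho B = p.
Proof.
case: p => M Q L_gt0 /in_targetP[sorted_M M0 SSYT_Q].
have sizes_M := sorted_row_sizes sorted_M.
have sizes0 : 0 \notin row_sizes M by rewrite mem0_row_sizes.
have M_L : size M <= L by rewrite -size_row_sizes (SSYT_height sizes_M SSYT_Q).
have [B insert_B shape_B] := shape_at_surj sorted_M SSYT_Q.
have size_B : size B = L.
  by rewrite -size_insert_rows -size_rev insert_B size_mkseq.
subst L; exists B => //; congr (_, _); last exact: rhoQ_SSYT_eq SSYT_Q shape_B.
rewrite rhoNE // insert_B; apply: (trim_top_eq (x0 := set0)) => // [|r].
  by apply/allP => Z ZM /=; apply: contraNneq M0 => <-.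
have [rB|Br] := ltnP r (size B); first by rewrite nth_mkseq.
by rewrite !nth_default ?size_mkseq // (leq_trans M_L).
Qed.

End Recording.

Theorem theorem4p19 (L n : nat) : 0 < L -> 0 < n ->
  [/\ (forall B1 B2 : seq {set 'I_n}, size B1 = L -> size B2 = L ->
          rho B1 = rho B2 -> B1 = B2),
      (forall B : seq {set 'I_n}, size B = L -> in_target L (rho B)),
      (forall p : seq {set 'I_n} * seq (seq nat), in_target L p ->
          exists2 B : seq {set 'I_n}, size B = L & rho B = p) &
      (forall B : seq {set 'I_n}, size B = L -> weight B = weight (rhoN B))].
Proof.
move=> L_gt0 _; split.
- by move=> B1 B2 size_B1 size_B2; apply: rho_inj; rewrite ?size_B1 ?size_B2.
- by move=> B size_B; rewrite -size_B; apply: rho_in_target; rewrite size_B.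
- by move=> p; apply: rho_surj.
- by move=> B size_B; apply: weight_rhoN; rewrite size_B.
Qed.
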